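(* Let $\xi_0<\xi_1$ be real numbers, let $n\ge0$ be an integer, and put $$u(\xi)=\frac{\xi-\xi_0}{\xi_1-\xi_0},\qquad v(\xi)=\frac{\xi_1-\xi}{\xi_1-\xi_0},\qquad \mathcal B^n_k(\xi)=\binom nk u(\xi)^kv(\xi)^{n-k}\quad(0\le k\le n).$$ Then: (P1) $\{\mathcal B^n_k\}_{k=0}^n$ is a basis of the space of polynomials of degree at most $n$ in $\xi$. (P2) $\sum_{k=0}^n\mathcal B^n_k(\xi)=(u(\xi)+v(\xi))^n=1$. (P3) $\mathcal B^n_k(\xi)\ge0$ for $\xi\in[\xi_0,\xi_1]$; hence the Bézier curve $\sum_k\mathbf w_k\mathcal B^n_k(\xi)$, $\xi\in[\xi_0,\xi_1]$, lies in the convex hull of its control points $\mathbf w_0,\dots,\mathbf w_n$. (P4) $\mathcal B^n_k(\xi_0)=\delta_{k,0}$ and $\mathcal B^n_k(\xi_1)=\delta_{k,n}$. (P5) $\mathcal B^n_k(\xi)=\mathcal B^n_{n-k}(\xi_0+\xi_1-\xi)$.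
   Context: Control points $\mathbf w_k$ are points of a real vector space $\mathbb R^d$; $\delta$ is the Kronecker delta. In the paper $\xi$ is the spectral variable of a nonuniform lattice and $[\xi_0,\xi_1]$ an interval containing the lattice support. *)

(* Defs.v *)
From mathcomp Require Import all_boot all_order all_algebra qpoly.
From mathcomp Require Import boolp classical_sets reals convex.

Set Implicit Arguments.
Unset Strict Implicit.
Unset Printing Implicit Defensive.

Import GRing.Theory Num.Theory.
Local Open Scope classical_set_scope.
Local Open Scope ring_scope.

Definition ucoord (R : realType) (xi0 xi1 xi : R) : R :=
  (xi - xi0) / (xi1 - xi0).

Definition vcoord (R : realType) (xi0 xi1 xi : R) : R :=
  (xi1 - xi) / (xi1 - xi0).

Definition bernstein (R : realType) (xi0 xi1 : R) (n k : nat) (xi : R) : R :=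
  'C(n, k)%:R * ucoord xi0 xi1 xi ^+ k * vcoord xi0 xi1 xi ^+ (n - k).

Definition bezier (R : realType) (xi0 xi1 : R) (n d : nat)
    (w : 'I_n.+1 -> 'rV[R]_d) (xi : R) : 'rV[R]_d :=
  \sum_(k < n.+1) bernstein xi0 xi1 n k xi *: w k.

Definition convex_hull (R : realType) (M : lmodType R) (A : set M) : set M :=
  smallest (@convex_set R M) A.

(* Main.v *)
Require Import Defs.
From mathcomp Require Import all_boot all_order all_algebra qpoly.
From mathcomp Require Import boolp classical_sets reals convex.
From mathcomp Require Import interval_inference ring.

Set Implicit Arguments.
Unset Strict Implicit.
Unset Printing Implicit Defensive.

Import Order.TTheory GRing.Theory Num.Theory.
Local Open Scope classical_set_scope.
Local Open Scope ring_scope.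

(** The functions [ucoord] and [vcoord] add up to 1 and are nonnegative on the interval, so the
    Bernstein functions are the terms of the binomial expansion of 1 to the power n and serve there
    as convex weights; [convex_set_sum] turns this into the hull property. Endpoint values come from
    one coordinate vanishing at each end, and symmetry from the reflection exchanging the two
    coordinates. For the basis, n+1 polynomials in a space of dimension n+1 only have to be
    independent: [upoly] has a root that [vpoly] lacks, so the coefficients can be peeled off one by
    one ([homogeneous_powers_free], [bernstein_poly_free]). *)

(* Evaluating at the root of [p] isolates [c 0]; the remaining terms are
   divisible by [p], which can be cancelled. *)
Lemma homogeneous_powers_free (R : idomainType) (p q : {poly R}) (a : R)
    (n : nat) (c : nat -> R) :
  p != 0 -> root p a -> ~~ root q a ->
  \sum_(k < n.+1) c k *: (p ^+ k * q ^+ (n - k)) = 0 ->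
  forall k : 'I_n.+1, c k = 0.
Proof.
move=> p0 pa qa; elim: n c => [|n IHn] c.
  rewrite big_ord1 mulr1 expr0 alg_polyC => /polyC_inj c0 k.
  by rewrite ord1.
rewrite big_ord_recl expr0 mul1r subn0.
under eq_bigr => k _ do rewrite lift0 subSS exprS -mulrA scalerAr.
rewrite -mulr_sumr => sum0.
have c0 : c 0%N = 0.
  have /eqP := congr1 (horner^~ a) sum0.
  rewrite !hornerE (rootP pa) mul0r addr0 mulf_eq0 expf_eq0 => /orP[/eqP//|].
  by rewrite -[_ == 0]/(root q a) (negPf qa) andbF.
move/eqP: sum0.
rewrite c0 scale0r add0r mulf_eq0 (negPf p0) => /eqP/(IHn (c \o succn)) cS k.
by case: (unliftP ord0 k) => [j|] ->; [exact: cS | ].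
Qed.

(** Convexity speaks of two points only; induct by splitting off the first point and renormalising
    the other weights by their total [1 - c ord0]. *)
Lemma convex_set_sum (R : realFieldType) (M : lmodType R) (A : set M) (n : nat)
    (c : 'I_n -> R) (x : 'I_n -> M) :
  convex_set A -> (forall i, 0 <= c i) -> \sum_i c i = 1 ->
  (forall i, A (x i)) -> A (\sum_i c i *: x i).
Proof.
move=> cA; elim: n c x => [|n IHn] c x c_ge0 c_sum Ax.
  by move/eqP: c_sum; rewrite big_ord0 eq_sym oner_eq0.
have rest : \sum_i c (lift ord0 i) = 1 - c ord0.
  by rewrite -c_sum big_ord_recl addrC addKr.
have rest_ge0 : 0 <= 1 - c ord0 by rewrite -rest sumr_ge0.
rewrite big_ord_recl.
(* If the total of the other weights is zero, no renormalisation is possible, but being nonnegative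
   they all vanish and only the first point remains. *)
have [c1|c1] := eqVneq (1 - c ord0) 0.
  have c_eq0 i : c (lift ord0 i) = 0.
    exact: (psumr_eq0P (fun j _ => c_ge0 (lift ord0 j)) (etrans rest c1)).
  rewrite big1 => [|i _]; last by rewrite c_eq0 scale0r.
  by rewrite addr0 -(subKr 1 (c ord0)) c1 subr0 scale1r.
have Ay : A (\sum_i (c (lift ord0 i) / (1 - c ord0)) *: x (lift ord0 i)).
  apply: IHn => // [i|]; first by rewrite divr_ge0.
  by rewrite -mulr_suml rest divff.
have c0_le1 : c ord0 <= 1 by rewrite -subr_ge0.
have := cA _ _ (Itv01 (c_ge0 ord0) c0_le1) (mem_set (Ax ord0)) (mem_set Ay).
move/set_mem; congr A; congr (_ + _).
rewrite scaler_sumr; apply: eq_bigr => i _ /=.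
by rewrite scalerA mulrC divfK.
Qed.

Section Bernstein.
Variables (R : realType) (xi0 xi1 : R).
Hypothesis lt_xi : xi0 < xi1.

Let xi_neq0 : xi1 - xi0 != 0.
Proof. by rewrite subr_eq0 gt_eqF. Qed.

Lemma ucoordDvcoord xi : ucoord xi0 xi1 xi + vcoord xi0 xi1 xi = 1.
Proof. by rewrite /ucoord /vcoord -mulrDl addrC subrKA divff. Qed.

Lemma sum_bernstein n xi :
  \sum_(k < n.+1) bernstein xi0 xi1 n k xi
    = (ucoord xi0 xi1 xi + vcoord xi0 xi1 xi) ^+ n.
Proof.
rewrite addrC exprDn; apply: eq_bigr => k _.
by rewrite /bernstein -mulrA mulr_natl mulrC.
Qed.

Lemma bernstein_ge0 n k xi :
  xi0 <= xi <= xi1 -> 0 <= bernstein xi0 xi1 n k xi.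
Proof.
move=> /andP[le0 le1]; have d0 : 0 <= xi1 - xi0 by rewrite subr_ge0 ltW.
by rewrite !mulr_ge0// exprn_ge0// divr_ge0// subr_ge0.
Qed.

Lemma bernstein_left n k : bernstein xi0 xi1 n k xi0 = (k == 0%N)%:R.
Proof.
rewrite /bernstein /ucoord /vcoord subrr mul0r divff// expr1n mulr1 expr0n.
by case: k => [|k]; rewrite ?bin0 ?mulr1 ?mulr0.
Qed.

Lemma bernstein_right n k :
  (k <= n)%N -> bernstein xi0 xi1 n k xi1 = (k == n)%:R.
Proof.
move=> le_kn; rewrite /bernstein /ucoord /vcoord subrr mul0r divff//.
(* The surviving factor is 0 to the power [n - k]; truncated subtraction gives exponent 0 exactly
   when [n <= k]. *)
rewrite expr1n mulr1 expr0n subn_eq0.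
have [->|ne] := eqVneq k n; first by rewrite binn leqnn mulr1.
by rewrite leqNgt ltn_neqAle ne le_kn mulr0.
Qed.

Lemma bernstein_sym n k xi : (k <= n)%N ->
  bernstein xi0 xi1 n k xi = bernstein xi0 xi1 n (n - k) (xi0 + xi1 - xi).
Proof.
move=> le_kn; rewrite /bernstein bin_sub// subKn// mulrAC.
have -> : ucoord xi0 xi1 (xi0 + xi1 - xi) = vcoord xi0 xi1 xi.
  by congr (_ / _); ring.
have -> // : vcoord xi0 xi1 (xi0 + xi1 - xi) = ucoord xi0 xi1 xi.
by congr (_ / _); ring.
Qed.

(** Formal counterparts of the two coordinates: independence is argued by cancellation in the
    integral domain of polynomials. *)
Definition upoly : {poly R} := (xi1 - xi0)^-1 *: ('X - xi0%:P).
Definition vpoly : {poly R} := (xi1 - xi0)^-1 *: (xi1%:P - 'X).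
Definition bernstein_poly n k : {poly R} :=
  'C(n, k)%:R *: (upoly ^+ k * vpoly ^+ (n - k)).

Lemma horner_upoly xi : upoly.[xi] = ucoord xi0 xi1 xi.
Proof. by rewrite !hornerE mulrC. Qed.

Lemma horner_vpoly xi : vpoly.[xi] = vcoord xi0 xi1 xi.
Proof. by rewrite !hornerE mulrC. Qed.

Lemma horner_bernstein_poly n k xi :
  (bernstein_poly n k).[xi] = bernstein xi0 xi1 n k xi.
Proof.
by rewrite hornerZ hornerM !horner_exp horner_upoly horner_vpoly mulrA.
Qed.

Lemma size_bernstein_poly n k :
  (k <= n)%N -> (size (bernstein_poly n k) <= n.+1)%N.
Proof.
have size_exp (p : {poly R}) m : (size p <= 2)%N -> (size (p ^+ m) <= m.+1)%N.
  move=> size_p; apply: leq_trans (size_poly_exp_leq _ _) _.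
  by rewrite ltnS -[leqRHS]mul1n leq_mul2r -subn1 leq_subLR size_p orbT.
have su : (size upoly <= 2)%N.
  by rewrite (leq_trans (size_scale_leq _ _))// size_XsubC.
have sv : (size vpoly <= 2)%N.
  by rewrite (leq_trans (size_scale_leq _ _))// -size_polyN opprB size_XsubC.
move=> le_kn; apply: leq_trans (size_scale_leq _ _) _.
apply: leq_trans (size_polyMleq _ _) _.
rewrite -subn1 leq_subLR add1n.
by rewrite (leq_trans (leq_add (size_exp _ _ su) (size_exp _ _ sv)))//
  addSn addnS subnKC.
Qed.

Lemma bernstein_poly_free n (c : nat -> R) :
  \sum_(k < n.+1) c k *: bernstein_poly n k = 0 ->
  forall k : 'I_n.+1, c k = 0.
Proof.
under eq_bigr => k _ do rewrite scalerA.
have pu : upoly.[xi0] = 0 by rewrite horner_upoly /ucoord subrr mul0r.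
have pv : vpoly.[xi0] = 1 by rewrite horner_vpoly /vcoord divff.
have u0 : upoly != 0.
  by rewrite scaler_eq0 invr_eq0 (negPf xi_neq0) polyXsubC_eq0.
have ru : root upoly xi0 by rewrite /root pu.
have rv : ~~ root vpoly xi0 by rewrite /root pv oner_eq0.
(* The binomials are absorbed into the coefficients, then divided out: they are nonzero because
   [k <= n] and the characteristic is 0. *)
move=> /(homogeneous_powers_free (c := fun k => c k * 'C(n, k)%:R)
  u0 ru rv) c0 k.
have /eqP := c0 k; rewrite mulf_eq0 pnatr_eq0 -leqn0 leqNgt bin_gt0.
by rewrite -ltnS ltn_ord orbF => /eqP.
Qed.

End Bernstein.

(* In the first clause, b is the tuple of polynomials inducing the functions
   bernstein xi0 xi1 n k; {poly_n.+1 R} is the space of polynomials of size at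
   most n.+1, i.e. of degree at most n. *)
Theorem proposition4p2 (R : realType) (xi0 xi1 : R) (n : nat)
    (lt_xi : xi0 < xi1) :
  [/\ exists2 b : n.+1.-tuple {poly_n.+1 R},
        forall (k : 'I_n.+1) (xi : R),
          (tnth b k : {poly R}).[xi] = bernstein xi0 xi1 n k xi
        & basis_of fullv b,
      forall xi : R,
        \sum_(k < n.+1) bernstein xi0 xi1 n k xi
          = (ucoord xi0 xi1 xi + vcoord xi0 xi1 xi) ^+ n
        /\ (ucoord xi0 xi1 xi + vcoord xi0 xi1 xi) ^+ n = 1,
      (forall (k : 'I_n.+1) (xi : R), xi0 <= xi <= xi1 ->
          0 <= bernstein xi0 xi1 n k xi)
      /\ (forall (d : nat) (w : 'I_n.+1 -> 'rV[R]_d) (xi : R),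
          xi0 <= xi <= xi1 -> convex_hull (range w) (bezier xi0 xi1 w xi)),
      forall k : 'I_n.+1,
        bernstein xi0 xi1 n k xi0 = (k == 0%N :> nat)%:R
        /\ bernstein xi0 xi1 n k xi1 = (k == n :> nat)%:R
    & forall (k : 'I_n.+1) (xi : R),
        bernstein xi0 xi1 n k xi
          = bernstein xi0 xi1 n (n - k) (xi0 + xi1 - xi)].
Proof.
split.
- pose b := [tuple npolyp n.+1 (bernstein_poly xi0 xi1 n k) | k < n.+1].
  have bE (k : 'I_n.+1) : tnth b k = bernstein_poly xi0 xi1 n k :> {poly R}.
    by rewrite tnth_mktuple npolypK// size_bernstein_poly// -ltnS.
  exists b => [k xi|]; first by rewrite bE horner_bernstein_poly.
  (* The tuple has as many entries as the dimension, so freeness alone remains and spanning is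
     automatic. *)
  rewrite basisEfree subvf size_tuple dimvf leqnn !andbT.
  apply/freeP => c c0 k.
  (* [inord] extends the ordinal-indexed coefficients to all naturals, as the lemma expects. *)
  have := @bernstein_poly_free _ _ _ lt_xi n (c \o inord) _ k.
  rewrite /= inord_val; apply.
  move/(congr1 (@polyn _ _)): c0; rewrite raddf_sum /=; apply: etrans.
  by apply: eq_bigr => i _; rewrite inord_val -bE (tnth_nth 0).
- by move=> xi; rewrite sum_bernstein ucoordDvcoord// expr1n.
- split=> [k xi|d w xi xi_in]; first exact: bernstein_ge0.
  (* The hull is an intersection, so membership is checked in each convex [A] containing the control
     points. *)
  move=> A [cA wA]; apply: convex_set_sum => // [k||k].
  + exact: bernstein_ge0.
  + by rewrite sum_bernstein ucoordDvcoord// expr1n.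
  + by apply: wA; exists k.
- by move=> k; rewrite bernstein_left// bernstein_right// -ltnS.
- by move=> k xi; rewrite -bernstein_sym// -ltnS.
Qed.
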